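(* Let $\Phi$ be a non-overlapping logic program and $A_1,\dots,A_n$, $C_1,\dots,C_m$ atomic formulas. Then $\Phi\vdash\{A_1,\dots,A_n\}\leadsto^*_\gamma\{C_1,\dots,C_m\}$ with $\{C_1,\dots,C_m\}$ in $\leadsto$-normal form if and only if $\Phi\vdash\{A_1,\dots,A_n\}(\to^\mu\cdot\hookrightarrow^1)^*_\gamma\{C_1,\dots,C_m\}$ with $\{C_1,\dots,C_m\}$ in $(\to^\mu\cdot\hookrightarrow^1)$-normal form.
   Context: Atomic formulas $P(t_1,\dots,t_n)$ over first-order terms; a logic program is a list of closed Horn formulas $\kappa:\forall\underline{x}.B_1,\dots,B_m\Rightarrow C$ ($m\ge0$) labelled by distinct constants $\kappa$; quantified variables are renamed apart at each use. Reductions on multisets of atomic formulas, each carrying a state substitution (initially empty): (LP-Unif) $\Phi\vdash\{A_1,\dots,A_i,\dots,A_n\}\leadsto_{\kappa,\gamma\cdot\gamma'}\{\gamma A_1,\dots,\gamma B_1,\dots,\gamma B_m,\dots,\gamma A_n\}$ for current state $\gamma'$, if $\kappa:\forall\underline{x}.B_1,\dots,B_m\Rightarrow C\in\Phi$ and $\gamma$ is a most general unifier of $C$ and $A_i$; (term-matching) $\Phi\vdash\{A_1,\dots,A_i,\dots,A_n\}\to_{\kappa,\gamma'}\{A_1,\dots,\sigma B_1,\dots,\sigma B_m,\dots,A_n\}$ (state unchanged) if $\kappa:\forall\underline{x}.B_1,\dots,B_m\Rightarrow C\in\Phi$ and $\sigma C\equiv A_i$; (substitutional) $\Phi\vdash\{A_1,\dots,A_i,\dots,A_n\}\hookrightarrow_{\kappa,\gamma\cdot\gamma'}\{\gamma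 A_1,\dots,\gamma A_i,\dots,\gamma A_n\}$ if $\kappa:\forall\underline{x}.B_1,\dots,B_m\Rightarrow C\in\Phi$ and $\gamma$ is a most general unifier of $C$ and $A_i$. $\to^\mu$ denotes a $\to$-reduction path to a $\to$-normal form (an infinite path if none exists); $\hookrightarrow^1$ denotes at most one $\hookrightarrow$ step; LP-Struct is the reduction relation $\to^\mu\cdot\hookrightarrow^1$, and a subscript $\gamma$ on a reduction sequence means its final accumulated state is $\gamma$. $\Phi$ is non-overlapping if for any two formulas $\forall\underline{x}.\underline{B}\Rightarrow C$ and $\forall\underline{x}.\underline{D}\Rightarrow E$ in $\Phi$ there are no substitutions $\sigma,\delta$ with $\sigma C\equiv\delta E$.
   Formalization: The state γ is compared only on the variables of A_1,…,A_n, and γ and the final goal up to one common renaming; term-matching instantiates only variables of the clause head; normal form for →^μ·↪^1 means no nonempty path, finite or infinite. *)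

(* Defs.v *)
From HB Require Import structures.
From mathcomp Require Import all_boot.

Set Implicit Arguments.
Unset Strict Implicit.
Unset Printing Implicit Defensive.

(* Arities are not declared: a symbol f applied to k arguments is read as the
   symbol f/k, so every first-order signature is covered. *)
Inductive term (F : Type) : Type :=
  | Var of nat
  | App of F & seq (term F).

Arguments Var {F} _.
Arguments App {F} _ _.

Section TermEqType.

Variable F : eqType.

Fixpoint term_encode (t : term F) : GenTree.tree (nat + F)%type :=
  match t with
  | Var x => GenTree.Leaf (inl x)
  | App f ts => GenTree.Node 0 (GenTree.Leaf (inr f) :: map term_encode ts)
  end.

Fixpoint term_decode (u : GenTree.tree (nat + F)%type) : term F :=
  match u with
  | GenTree.Leaf (inl x) => Var x
  | GenTree.Node _ (GenTree.Leaf (inr f) :: us) => App f (map term_decode us)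
  | _ => Var 0
  end.

Lemma term_encodeK : cancel term_encode term_decode.
Proof.
rewrite /cancel; fix IH 1; case=> [x|f ts] //=; congr App.
by elim: ts => [|t ts IHts] //=; rewrite IH IHts.
Qed.

HB.instance Definition _ := Equality.copy (term F) (can_type term_encodeK).

End TermEqType.

Section Syntax.

Variables F P K : eqType.

Definition atom : Type := (P * seq (term F))%type.

(* A goal is a multiset of atoms, presented as a list; a step may act at any
   position, and the final goal is compared up to permutation. *)
Definition goal : Type := seq atom.

(* (Bs, C) stands for the closed Horn formula  forall xs. Bs => C  where xs are
   all the variables of Bs and C; a body variable need not occur in C. *)
Definition clause : Type := (seq atom * atom)%type.

Definition body (cl : clause) : seq atom := cl.1.
Definition head (cl : clause) : atom := cl.2.

Definition program : Type := seq (K * clause).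

Definition distinct_labels (Phi : program) : Prop := uniq (unzip1 Phi).

Fixpoint tvars (t : term F) : seq nat :=
  match t with
  | Var x => [:: x]
  | App _ ts => flatten (map tvars ts)
  end.

Definition avars (a : atom) : seq nat := flatten (map tvars a.2).
Definition gvars (G : goal) : seq nat := flatten (map avars G).
Definition cvars (cl : clause) : seq nat := avars (head cl) ++ gvars (body cl).

Definition subst : Type := nat -> term F.

Fixpoint tsubst (s : subst) (t : term F) : term F :=
  match t with
  | Var x => s x
  | App f ts => App f (map (tsubst s) ts)
  end.

Definition asubst (s : subst) (a : atom) : atom := (a.1, map (tsubst s) a.2).
Definition gsubst (s : subst) (G : goal) : goal := map (asubst s) G.
Definition csubst (s : subst) (cl : clause) : clause :=
  (gsubst s (body cl), asubst s (head cl)).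

Definition subst_id : subst := fun x => Var x.

(* g . g' applies g' first. *)
Definition subst_comp (g g' : subst) : subst := fun x => tsubst g (g' x).

Definition renaming (r : nat -> nat) : subst := fun x => Var (r x).

(* s is the identity outside the finite set V and maps V to terms over V. *)
Definition supported_on (s : subst) (V : seq nat) : Prop :=
  (forall x, x \notin V -> s x = Var x) /\
  (forall x, x \in V -> {subset tvars (s x) <= V}).

Definition is_mgu (g : subst) (a b : atom) : Prop :=
  asubst g a = asubst g b /\
  forall th : subst, asubst th a = asubst th b ->
    exists d : subst, forall x, th x = subst_comp d g x.

(* Matching instantiates the variables of C only: body variables not occurring
   in C stay fresh, instead of being instantiated arbitrarily. *)
Definition is_matcher (s : subst) (C a : atom) : Prop :=
  asubst s C = a /\ forall x, x \notin avars C -> s x = Var x.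

Definition non_overlapping (Phi : program) : Prop :=
  forall (k1 k2 : K) (c1 c2 : clause),
    (k1, c1) \in Phi -> (k2, c2) \in Phi -> k1 != k2 ->
    ~ exists s d : subst, asubst s (head c1) = asubst d (head c2).

(* [used] bounds the variables met so far in the derivation, including those
   of the initial goal.  It only serves to rename clauses apart: since matching
   does not record anything in the state, neither the goal nor the state is
   enough to know which variables are fresh. *)
Record config : Type := Config {
  cgoal : goal;
  cstate : subst;
  used : seq nat
}.

Definition init (A : goal) : config := Config A subst_id (gvars A).

Section Reductions.

Variable Phi : program.

(* V' is any finite extension of V which covers the renamed clause. *)
Definition renamed_apart (k : K) (cl : clause) (V V' : seq nat) : Prop :=
  (exists (cl0 : clause) (r : nat -> nat),
      [/\ (k, cl0) \in Phi, injective r & cl = csubst (renaming r) cl0]) /\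
  [/\ {in cvars cl, forall x, x \notin V},
      {subset V <= V'} & {subset cvars cl <= V'}].

(* The mgu is arbitrary (it need not be idempotent, nor restricted to the
   variables of the unified atoms), but its support is finite. *)
Inductive unif_step : config -> config -> Prop :=
  UnifStep k cl g G1 a G2 st V V' of
      renamed_apart k cl V V'
    & is_mgu g (head cl) a
    & supported_on g V' :
    unif_step (Config (G1 ++ a :: G2) st V)
              (Config (gsubst g (G1 ++ body cl ++ G2)) (subst_comp g st) V').

Inductive tm_step : config -> config -> Prop :=
  TmStep k cl s G1 a G2 st V V' of
      renamed_apart k cl V V'
    & is_matcher s (head cl) a :
    tm_step (Config (G1 ++ a :: G2) st V)
            (Config (G1 ++ gsubst s (body cl) ++ G2) st V').

Inductive sub_step : config -> config -> Prop :=
  SubStep k cl g G1 a G2 st V V' of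
      renamed_apart k cl V V'
    & is_mgu g (head cl) a
    & supported_on g V' :
    sub_step (Config (G1 ++ a :: G2) st V)
             (Config (gsubst g (G1 ++ a :: G2)) (subst_comp g st) V').

End Reductions.

End Syntax.

Arguments Config {F P} _ _ _.
Arguments subst_id {F} _.

Section Paths.

Variables (T : Type) (R : T -> T -> Prop).

Inductive path_of_length : nat -> T -> T -> Prop :=
  | path_nil x : path_of_length 0 x x
  | path_cons n x y z of R x y & path_of_length n y z :
      path_of_length n.+1 x z.

Definition star (x y : T) : Prop := exists n, path_of_length n x y.

Definition infinite_path (x : T) : Prop :=
  exists f : nat -> T, f 0 = x /\ forall i, R (f i) (f i.+1).

Definition irreducible (x : T) : Prop := ~ exists y, R x y.

End Paths.

Section Relations.

Variables (F P K : eqType) (Phi : program F P K).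

Let cfg := config F P.

Definition mu_path (n : nat) (c c' : cfg) : Prop :=
  path_of_length (tm_step Phi) n c c' /\ irreducible (tm_step Phi) c'.

Definition sub_path1 (n : nat) (c c' : cfg) : Prop :=
  n <= 1 /\ path_of_length (sub_step Phi) n c c'.

(* n is the total number of elementary steps. *)
Definition struct_path (n : nat) (c c' : cfg) : Prop :=
  exists (n1 n2 : nat) (d : cfg),
    [/\ mu_path n1 c d, sub_path1 n2 d c' & n = n1 + n2].

Definition struct_step (c c' : cfg) : Prop := exists n, struct_path n c c'.

Definition unif_normal (C : goal F P) : Prop := irreducible (unif_step Phi) (init C).

(* Both components of a struct step may be empty paths, so a normal form is a
   goal from which no nonempty path, finite or infinite, starts. *)
Definition struct_normal (C : goal F P) : Prop :=
  ~ infinite_path (tm_step Phi) (init C) /\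
  forall n c', struct_path n (init C) c' -> n = 0.

(* (g, C) is a variant of the answer (state, goal) in c: one renaming acts on
   the goal and on the values of the state at the variables of A.  The values
   at other variables are bindings of renamed-apart clause variables. *)
Definition answer_variant (A : goal F P) (c : cfg) (g : subst F) (C : goal F P) : Prop :=
  exists r : nat -> nat,
    [/\ bijective r,
        perm_eq C (gsubst (renaming F r) (cgoal c))
      & {in gvars A, forall x, g x = tsubst (renaming F r) (cstate c x)}].

Definition reduces (R : cfg -> cfg -> Prop) (A : goal F P) (g : subst F) (C : goal F P) : Prop :=
  exists c : cfg, star R (init A) c /\ answer_variant A c g C.

Definition unif_reduces := reduces (unif_step Phi).

Definition struct_reduces := reduces struct_step.

End Relations.

(* Main.v *)
(* A term-matching step is an LP-Unif step, because a matcher is an mgu fixing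
   the goal and the state, and an LP-Unif step is a substitutional step followed
   by term-matching of the instantiated atom.  Everything hence reduces to one
   commutation property: a term-matching step and an LP-Unif step from the same
   goal either act on equal atoms, and then agree up to renaming since the
   program does not overlap, or close a diamond in one step each.  Therefore a
   term-matching step from a goal that reaches an LP-Unif normal form in n steps
   leaves a goal that reaches it in n - 1 steps.  It follows that term-matching
   terminates on such goals, which turns LP-Unif reductions into LP-Struct ones by
   induction on n; conversely, the term-matching step induced by a substitutional
   step can be moved to the front of the LP-Unif reduction of the remainder.  No
   exchange of two proper unification steps is needed. *)
Require Import Defs.
From mathcomp Require Import all_boot.
From Stdlib Require Import Classical ClassicalEpsilon.

Set Implicit Arguments.
Unset Strict Implicit.
Unset Printing Implicit Defensive.

(** Variants demand bijections of [nat], while only finitely many values are ever prescribed; these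
    are set right one point at a time by composing with a transposition. *)
Lemma injective_in_extend (L : seq nat) (f : nat -> nat) :
  {in L &, injective f} -> exists2 r : nat -> nat, bijective r & {in L, r =1 f}.
Proof.
elim: L => [|x L IH] injf; first by exists id => //; exists id.
have [|r bij_r rf] := IH.
  by move=> y z yL zL; apply: injf; rewrite inE ?yL ?zL orbT.
(* [sw] exchanges [r x] and [f x]; injectivity of [r], and of [f] on the list, keeps it from
   disturbing the values that are already right. *)
pose sw y := if y == r x then f x else if y == f x then r x else y.
have swK : cancel sw sw.
  move=> y; rewrite /sw; case: (eqVneq y (r x)) => [->|nyr].
    by case: eqVneq => [->|_] //; rewrite eqxx.
  by case: (eqVneq y (f x)) => [->|nyf]; rewrite ?eqxx // (negPf nyr) (negPf nyf).
exists (sw \o r) => [|y]; first by apply: bij_comp => //; exists sw.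
rewrite inE /= => /orP [/eqP ->|yL]; first by rewrite /sw eqxx.
rewrite /sw (inj_eq (bij_inj bij_r)).
case: eqVneq => [->//|nyx]; rewrite rf //.
case: eqVneq => // fyx; case/eqP: nyx.
by apply: injf => //; rewrite inE ?eqxx ?yL ?orbT.
Qed.

(** * Reduction paths *)

Section Paths.

Variables (T : Type) (R : T -> T -> Prop).

Lemma path0_eq x y : path_of_length R 0 x y -> x = y.
Proof. by move=> p; inversion p. Qed.

Lemma pathS_inv n x z :
  path_of_length R n.+1 x z -> exists2 y, R x y & path_of_length R n y z.
Proof. by move=> p; inversion p; exists y. Qed.

Lemma path_rcons n x y z : path_of_length R n x y -> R y z -> path_of_length R n.+1 x z.
Proof.
elim=> {n x y} [x|n x y w xy _ IH] xz; first by apply: path_cons xz _; apply: path_nil.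
exact: path_cons xy (IH xz).
Qed.

Lemma terminating_normal x :
  ~ infinite_path R x -> exists n y, path_of_length R n x y /\ irreducible R y.
Proof.
move=> no_inf; apply: NNPP => no_normal; apply: no_inf.
(* Dependent choice: every point reachable from [x] has a successor, and choosing one repeatedly
   builds an infinite path. *)
pose S := {y | exists n, path_of_length R n x y}.
have next (u : S) : {v : S | R (sval u) (sval v)}.
  apply: constructive_indefinite_description.
  case: u => y [n xy] /=; have [z yz] : exists z, R y z.
    by apply: NNPP => irr; apply: no_normal; exists n, y.
  by exists (exist _ z (ex_intro _ n.+1 (path_rcons xy yz))).
pose u0 : S := exist _ x (ex_intro _ 0 (path_nil R x)).
exists (fun i => sval (iter i (fun u => sval (next u)) u0)); split=> // i.
exact: svalP (next _).
Qed.

End Paths.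

(** * Substitutions and most general unifiers *)

Section Terms.

Variable F : eqType.

Lemma term_ind_in (Q : term F -> Prop) :
  (forall x, Q (Var x)) ->
  (forall f ts, {in ts, forall t, Q t} -> Q (App f ts)) -> forall t, Q t.
Proof.
move=> QV QA; fix IH 1; case=> [x|f ts]; first exact: QV.
apply: QA; elim: ts => [|u ts IHts] t.
  (* [IH] is cleared so that the closing tactic cannot make an unguarded call to it. *)
  by clear IH; rewrite in_nil.
rewrite inE => /orP [/eqP ->|]; [exact: IH | exact: IHts].
Qed.

Implicit Types (s d th : subst F) (t : term F) (r : nat -> nat).

Lemma eq_in_tsubst s s' t : {in tvars t, s =1 s'} <-> tsubst s t = tsubst s' t.
Proof.
elim/term_ind_in: t => [x|f ts IH] /=.
  by split=> [->//|e y]; rewrite ?inE // => /eqP ->.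
split=> [e|[/eq_in_map e] x /flatten_mapP [t tts xt]].
  congr App; apply/eq_in_map => t tts; apply/IH => // x xt.
  by apply: e; apply/flatten_mapP; exists t.
by move: x xt; apply/IH => //; apply: e.
Qed.

Lemma tsubst_comp s s' t : tsubst s (tsubst s' t) = tsubst (subst_comp s s') t.
Proof.
elim/term_ind_in: t => [x|f ts IH] //=.
by rewrite -map_comp; congr App; apply/eq_in_map => t /IH.
Qed.

Lemma tsubst_id s t : {in tvars t, s =1 Var} -> tsubst s t = t.
Proof.
move=> /eq_in_tsubst ->; elim/term_ind_in: t => [x|f ts IH] //=.
by congr App; rewrite -[RHS]map_id; apply/eq_in_map => t /IH.
Qed.

Lemma tvars_subst s t x :
  reflect (exists2 y, y \in tvars t & x \in tvars (s y)) (x \in tvars (tsubst s t)).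
Proof.
apply: (iffP idP); elim/term_ind_in: t => [y|f ts IH] /=.
- by move=> xy; exists y; rewrite ?inE.
- case/flatten_mapP=> _ /mapP [t tts ->] /(IH _ tts) [y yt xy].
  by exists y => //; apply/flatten_mapP; exists t.
- by case=> z; rewrite inE => /eqP ->.
- case=> y /flatten_mapP [t tts yt] xy; apply/flatten_mapP.
  by exists (tsubst s t); [exact: map_f | apply: IH => //; exists y].
Qed.

(** No substitution turns an application into a variable, so only variables can be mapped back to
    variables by [d']. *)
Lemma subst_var_image d d' t x :
  tsubst d' (tsubst d t) = t -> x \in tvars t ->
  exists2 y, d x = Var y & d' y = Var x.
Proof.
rewrite tsubst_comp -[RHS](tsubst_id (s := Var)) // => /eq_in_tsubst e /e.
by rewrite /subst_comp; case: (d x) => //= y <-; exists y.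
Qed.

Lemma renaming_extend (L : seq nat) d :
  {in L, forall x, exists y, d x = Var y} -> {in L &, injective d} ->
  exists2 r, bijective r & {in L, renaming F r =1 d}.
Proof.
(* The default [0] is never taken on [L], where [d] is variable-valued. *)
move=> var inj; pose f x := if d x is Var y then y else 0.
have df : {in L, forall x, d x = Var (f x)} by move=> x /var [y e]; rewrite /f e.
have [|r bij_r rf] := @injective_in_extend L f.
  by move=> x y xL yL e; apply: inj => //; rewrite !df // e.
by exists r => // x xL; rewrite /renaming rf // df.
Qed.

End Terms.

Section Atoms.

Variables F P : eqType.
Implicit Types (s d g th : subst F) (t : term F) (r : nat -> nat).
Implicit Types (a b C : atom F P) (G : goal F P).

Lemma eq_in_asubst s s' a : {in avars a, s =1 s'} <-> asubst s a = asubst s' a.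
Proof.
case: a => p ts; rewrite /asubst /avars /=.
split=> [e|[/eq_in_map e] x /flatten_mapP [t tts]].
  congr pair; apply/eq_in_map => t tts; apply/eq_in_tsubst => x xt.
  by apply: e; apply/flatten_mapP; exists t.
by move: x; apply/eq_in_tsubst; apply: e.
Qed.

Lemma asubst_comp s s' a : asubst s (asubst s' a) = asubst (subst_comp s s') a.
Proof.
rewrite /asubst /= -map_comp; congr pair; apply: eq_map => t.
exact: tsubst_comp.
Qed.

Lemma asubst_id s a : {in avars a, s =1 Var} -> asubst s a = a.
Proof.
case: a => p ts; rewrite /asubst /avars /= => e; congr pair.
rewrite -[RHS]map_id; apply/eq_in_map => t tts; apply: tsubst_id => x xt.
by apply: e; apply/flatten_mapP; exists t.
Qed.

Lemma avars_subst s a x :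
  reflect (exists2 y, y \in avars a & x \in tvars (s y)) (x \in avars (asubst s a)).
Proof.
case: a => p ts; rewrite /avars /=; apply: (iffP flatten_mapP).
  case=> _ /mapP [t tts ->] /tvars_subst [y yt xy].
  by exists y => //; apply/flatten_mapP; exists t.
case=> y /flatten_mapP [t tts yt] xy.
by exists (tsubst s t); [exact: map_f | apply/tvars_subst; exists y].
Qed.

Lemma eq_in_gsubst s s' G : {in gvars G, s =1 s'} -> gsubst s G = gsubst s' G.
Proof.
move=> e; apply/eq_in_map => a aG; apply/eq_in_asubst => x xa.
by apply: e; apply/flatten_mapP; exists a.
Qed.

Lemma gsubst_comp s s' G : gsubst s (gsubst s' G) = gsubst (subst_comp s s') G.
Proof. by rewrite /gsubst -map_comp; apply: eq_map => a; apply: asubst_comp. Qed.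

Lemma gsubst_id s G : {in gvars G, s =1 Var} -> gsubst s G = G.
Proof.
move=> e; rewrite -[RHS]map_id; apply/eq_in_map => a aG; apply: asubst_id => x xa.
by apply: e; apply/flatten_mapP; exists a.
Qed.

Lemma gvars_subst s G x :
  reflect (exists2 y, y \in gvars G & x \in tvars (s y)) (x \in gvars (gsubst s G)).
Proof.
apply: (iffP flatten_mapP).
  case=> _ /mapP [a aG ->] /avars_subst [y ya xy].
  by exists y => //; apply/flatten_mapP; exists a.
case=> y /flatten_mapP [a aG ya] xy.
by exists (asubst s a); [exact: map_f | apply/avars_subst; exists y].
Qed.

Lemma gsubst_cat s G G' : gsubst s (G ++ G') = gsubst s G ++ gsubst s G'.
Proof. exact: map_cat. Qed.

Lemma gvars_cat G G' : gvars (G ++ G') = gvars G ++ gvars G'.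
Proof. by rewrite /gvars map_cat flatten_cat. Qed.

Lemma gvars_cons a G : gvars (a :: G) = avars a ++ gvars G.
Proof. by []. Qed.

Lemma perm_gvars G G' : perm_eq G G' -> gvars G =i gvars G'.
Proof.
move=> e x; apply/flatten_mapP/flatten_mapP => -[a aG xa]; exists a => //.
  by rewrite -(perm_mem e).
by rewrite (perm_mem e).
Qed.

(** * Supports, and most general unifiers up to renaming *)

Lemma supported_on_mono g V V' :
  supported_on g V -> {subset V <= V'} -> supported_on g V'.
Proof.
move=> [out ins] sub; split=> x xV'; first by rewrite out //; apply: contra xV'; apply: sub.
case: (boolP (x \in V)) => [xV y /(ins _ xV) /sub //|/out ->] y /=.
by rewrite inE => /eqP ->.
Qed.

(** Each mgu factors through the other, and the two factors cancel on the variables of the terms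
    [g x]; so the factor [d] renames these variables injectively. Finiteness of [L] lets it extend
    to a bijection. *)
Lemma mgu_unique (L : seq nat) g g' a b :
  is_mgu g a b -> is_mgu g' a b ->
  exists2 r, bijective r & {in L, forall x, g' x = tsubst (renaming F r) (g x)}.
Proof.
move=> [u m] [u' m']; have [d dE] := m _ u'; have [d' d'E] := m' _ u.
have dK x z : z \in tvars (g x) -> exists2 y, d z = Var y & d' y = Var z.
  by apply: subst_var_image; rewrite -[LHS]/(tsubst d' (subst_comp d g x)) -dE [RHS]d'E.
pose M := flatten (map (fun x => tvars (g x)) L).
have [||r bij_r rd] := @renaming_extend _ M d.
- by move=> z /flatten_mapP [x _ /dK [y -> _]]; exists y.
- move=> z z' /flatten_mapP [x _ /dK [y -> e]] /flatten_mapP [x' _ /dK [y' -> e']] [yy'].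
  by move: e'; rewrite -yy' e => -[].
exists r => // x xL; rewrite dE; apply/eq_in_tsubst => z zx.
by rewrite rd //; apply/flatten_mapP; exists x.
Qed.

(* Variables foreign to the unification problem are merely renamed by an mgu g:
   sending them to fresh variables, and the others where g does, is a unifier. *)
Lemma mgu_fresh g a b (V Y : seq nat) (p : nat -> nat) :
  is_mgu g a b -> supported_on g V ->
  {in Y, forall x, (x \notin avars a) && (x \notin avars b)} ->
  {in Y, forall x, p x \notin V} -> {in Y &, injective p} ->
  exists2 r, bijective r &
    {in V, forall x, tsubst (renaming F r) (g x) = if x \in Y then Var (p x) else g x}.
Proof.
move=> [u m] supp Yab pV injp; pose th x := if x \in Y then Var (p x) else g x.
have thE (c : atom F P) : (forall x, x \in Y -> x \notin avars c) -> asubst th c = asubst g c.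
  move=> Yc; apply/eq_in_asubst => x xc; rewrite /th ifN //.
  by apply: contraL xc; apply: Yc.
have [|d dE] := m th.
  by rewrite !thE // => x /Yab /andP [].
have d_out x z : x \notin Y -> z \in tvars (g x) -> d z = Var z.
  move=> xY; move: (dE x); rewrite /th ifN // => e.
  move: z; apply/eq_in_tsubst; rewrite -[LHS]e; apply/esym; exact: tsubst_id.
have d_in x : x \in Y -> exists2 z, g x = Var z & d z = Var (p x).
  move=> xY; move: (dE x); rewrite /th xY /subst_comp.
  by case: (g x) => //= z ->; exists z.
have d_cases x z : x \in V -> z \in tvars (g x) ->
    (z \in V /\ d z = Var z) \/ (exists y, [/\ y \in Y, g y = Var z & d z = Var (p y)]).
  move=> xV zx; case: (boolP (x \in Y)) => xY.
    have [z' e e'] := d_in _ xY; right; exists x.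
    by move: zx; rewrite e /= inE => /eqP ->.
  by left; split; [exact: supp.2 zx | exact: d_out zx].
pose M := flatten (map (fun x => tvars (g x)) V).
(* By [d_cases], values of [d] on [M] are either the variable itself, inside [V], or some [p y],
   outside [V]; no clash is possible since [p] is injective on [Y]. *)
have [||r bij_r rd] := @renaming_extend _ M d.
- move=> z /flatten_mapP [x xV zx].
  by case: (d_cases _ _ xV zx) => [[_ ->]|[y [_ _ ->]]]; [exists z | exists (p y)].
- move=> z z' /flatten_mapP [x xV zx] /flatten_mapP [x' xV' zx'].
  case: (d_cases _ _ xV zx) => [[zV ->]|[y [yY gy ->]]];
    case: (d_cases _ _ xV' zx') => [[zV' ->]|[y' [yY' gy' ->]]] [] //.
  + by move=> e; case/negP: (pV _ yY'); rewrite -e.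
  + by move=> e; case/negP: (pV _ yY); rewrite e.
  + by move=> /injp e; move: gy'; rewrite -e // gy => -[].
exists r => // x xV; rewrite -/(th x) dE; apply/eq_in_tsubst => z zx.
by rewrite rd //; apply/flatten_mapP; exists x.
Qed.

(** The witness is the conjugate of [g] by [r]: a unifier of the renamed atoms, precomposed with
    [r], unifies [a] and [b], hence factors through [g]. *)
Lemma mgu_conj g a b (V : seq nat) r :
  is_mgu g a b -> supported_on g V -> bijective r ->
  exists g' V', [/\ is_mgu g' (asubst (renaming F r) a) (asubst (renaming F r) b),
    supported_on g' V' & forall x, g' (r x) = tsubst (renaming F r) (g x)].
Proof.
move=> [u m] [out ins] [ri rK riK]; pose g' x := tsubst (renaming F r) (g (ri x)).
have g'E x : g' (r x) = tsubst (renaming F r) (g x) by rewrite /g' rK.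
have g'r (c : atom F P) : asubst g' (asubst (renaming F r) c) = asubst (renaming F r) (asubst g c).
  by rewrite !asubst_comp; apply/eq_in_asubst => x _; apply: g'E.
exists g', (map r V); split=> //.
  split=> [|th]; first by rewrite !g'r u.
  rewrite !asubst_comp => /m [d dE]; exists (subst_comp d (renaming F ri)) => x.
  move: (dE (ri x)); rewrite {1}/subst_comp /= riK => ->.
  rewrite -[RHS]/(tsubst (subst_comp d (renaming F ri)) (tsubst (renaming F r) (g (ri x)))).
  rewrite tsubst_comp; apply/eq_in_tsubst => z _.
  by rewrite /subst_comp /= rK.
split=> [x xV|_ /mapP [x xV ->] y].
  by rewrite /g' out /= /renaming ?riK //; apply: contra xV => /(map_f r); rewrite riK.
rewrite g'E => /tvars_subst [z zx]; rewrite /= inE => /eqP ->.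
exact: map_f (ins _ xV _ zx).
Qed.

(** With variables apart, [s] fixes [a] and so unifies. Any unifier [th] serves as its own factor:
    [th] and [th] after [s] agree on the variables of [C] because [th] unifies, and elsewhere
    because [s] is the identity. *)
Lemma matcher_mgu s C a :
  is_matcher s C a -> {in avars a, forall x, x \notin avars C} -> is_mgu s C a.
Proof.
move=> [e out] disj; have sa : asubst s a = a by apply: asubst_id => x /disj /out.
split=> [|th eth]; first by rewrite e sa.
exists th => x; case: (boolP (x \in avars C)) => [|/out e']; last first.
  by rewrite /subst_comp e'.
by move: x; apply/eq_in_asubst; rewrite -asubst_comp e.
Qed.

(** * Renamed instances of clauses *)

Lemma cvars_renaming r (cl : clause F P) :
  cvars (csubst (renaming F r) cl) = map r (cvars cl).
Proof.
have tv t : tvars (tsubst (renaming F r) t) = map r (tvars t).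
  elim/term_ind_in: t => [x|f ts IH] //=.
  by rewrite -map_comp map_flatten -map_comp; congr flatten; apply/eq_in_map => t /IH.
have av a : avars (asubst (renaming F r) a) = map r (avars a).
  by rewrite /avars /= -map_comp map_flatten -map_comp; congr flatten; apply: eq_map.
rewrite /cvars map_cat /= av; congr cat.
by rewrite /gvars -map_comp map_flatten -map_comp; congr flatten; apply: eq_map => a /=.
Qed.

Lemma csubst_renaming_ext r r' (cl : clause F P) :
  {in cvars cl, r =1 r'} -> csubst (renaming F r) cl = csubst (renaming F r') cl.
Proof.
move=> e; rewrite /csubst; congr pair.
  by apply: eq_in_gsubst => x xB; rewrite /renaming e // mem_cat xB orbT.
by apply/eq_in_asubst => x xC; rewrite /renaming e // mem_cat xC.
Qed.

Lemma csubst_comp s s' (cl : clause F P) : csubst s (csubst s' cl) = csubst (subst_comp s s') cl.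
Proof. by rewrite /csubst /= gsubst_comp asubst_comp. Qed.

(** Both [r] and [r'] agree with bijections on the finitely many clause variables; one is inverted
    and followed by the other. *)
Lemma renaming_between r r' (cl : clause F P) :
  injective r -> injective r' ->
  exists2 p, bijective p &
    csubst (renaming F p) (csubst (renaming F r) cl) = csubst (renaming F r') cl.
Proof.
move=> inj inj'.
have [|q [qi qK qiK] qr] := @injective_in_extend (cvars cl) r; first by move=> x y _ _ /inj.
have [|q' bq' qr'] := @injective_in_extend (cvars cl) r'; first by move=> x y _ _ /inj'.
exists (q' \o qi); first by apply: bij_comp => //; exists q.
rewrite csubst_comp -[subst_comp _ _]/(renaming F (q' \o qi \o r)).
by apply: csubst_renaming_ext => x xc; rewrite /= -qr // qK qr'.
Qed.

Lemma fresh_renaming (V : seq nat) :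
  exists2 r : nat -> nat, injective r & forall x, r x \notin V.
Proof.
exists (addn (\max_(y <- V) y).+1) => [|x]; first exact: addnI.
apply/negP => xV; have := @leq_bigmax_seq _ V predT id _ xV isT.
by rewrite /= addSn ltnNge leq_addr.
Qed.

End Atoms.

(** * Goals up to renaming *)

Local Notation head := Defs.head.

Section Configurations.

Variables (F P K : eqType) (Phi : program F P K) (X : seq nat).

Implicit Types (c d e u : config F P) (G R : goal F P) (a b : atom F P).
Implicit Types (cl : clause F P) (k : K) (s g st : subst F) (V : seq nat) (r : nat -> nat).

(** The record type leaves [used] unconstrained. Under this invariant, a clause apart from [used c]
    is apart from the goal and from the relevant part of the state. *)
Definition wf c : Prop :=
  {subset gvars (cgoal c) <= used c} /\
  {in X, forall x, {subset tvars (cstate c x) <= used c}}.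

(* Only the values of the state on X, the variables of the initial goal, count. *)
Definition variant c c' : Prop :=
  exists r : nat -> nat,
    [/\ bijective r, perm_eq (cgoal c') (gsubst (renaming F r) (cgoal c))
      & {in X, forall x, cstate c' x = tsubst (renaming F r) (cstate c x)}].

Lemma variant_id c c' :
  perm_eq (cgoal c') (cgoal c) -> {in X, cstate c' =1 cstate c} -> variant c c'.
Proof.
move=> eG est; exists id; split=> [||x xX]; first by exists id.
  by rewrite gsubst_id.
by rewrite tsubst_id // est.
Qed.

Lemma variant_refl c : variant c c.
Proof. exact: variant_id. Qed.

Lemma variant_trans c d e : variant c d -> variant d e -> variant c e.
Proof.
move=> [r [br pr sr]] [q [bq pq sq]]; exists (q \o r); split; first exact: bij_comp.
  by rewrite (perm_trans pq) // (perm_trans (perm_map _ pr)) // -/(gsubst _ _) gsubst_comp.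
by move=> x xX; rewrite sq // sr // tsubst_comp.
Qed.

Lemma variant_sym c d : variant c d -> variant d c.
Proof.
move=> [r [[q rK qK] pr sr]]; exists q; split; first by exists r.
  rewrite perm_sym (perm_trans (perm_map _ pr)) // -/(gsubst _ _) gsubst_comp gsubst_id // => x _.
  by rewrite /subst_comp /= /renaming rK.
by move=> x xX; rewrite sr // tsubst_comp tsubst_id // => y _; rewrite /subst_comp /= /renaming rK.
Qed.

(** * Steps up to the order of atoms, and preservation of the invariant *)

Lemma perm_splitP G a R :
  perm_eq G (a :: R) -> exists G1 G2, G = G1 ++ a :: G2 /\ perm_eq (G1 ++ G2) R.
Proof.
move=> e; have /splitPr H : a \in G by rewrite (perm_mem e) mem_head.
case: H e => G1 G2 e; exists G1, G2; split=> //.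
by rewrite -(perm_cons a) -(perm_catCA G1 [:: a] G2).
Qed.

Lemma unif_step_at G st V a R k cl g V' :
  perm_eq G (a :: R) -> renamed_apart Phi k cl V V' ->
  is_mgu g (head cl) a -> supported_on g V' ->
  exists2 G', unif_step Phi (Config G st V) (Config G' (subst_comp g st) V') &
    perm_eq G' (gsubst g (body cl ++ R)).
Proof.
move=> /perm_splitP [G1 [G2 [-> e]]] ra mg sg; eexists; first exact: UnifStep ra mg sg.
by apply: perm_map; rewrite perm_catCA perm_cat2l.
Qed.

Lemma tm_step_at G st V a R k cl s V' :
  perm_eq G (a :: R) -> renamed_apart Phi k cl V V' -> is_matcher s (head cl) a ->
  exists2 G', tm_step Phi (Config G st V) (Config G' st V') &
    perm_eq G' (gsubst s (body cl) ++ R).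
Proof.
move=> /perm_splitP [G1 [G2 [-> e]]] ra mg; eexists; first exact: TmStep ra mg.
by rewrite perm_catCA perm_cat2l.
Qed.

Lemma tvars_supported g V t :
  supported_on g V -> {subset tvars t <= V} -> {subset tvars (tsubst g t) <= V}.
Proof. by move=> [_ sg] tV x /tvars_subst [y /tV /sg h /h]. Qed.

Lemma gvars_supported g V G :
  supported_on g V -> {subset gvars G <= V} -> {subset gvars (gsubst g G) <= V}.
Proof. by move=> [_ sg] GV x /gvars_subst [y /GV /sg h /h]. Qed.

Lemma matcher_supported s V a b :
  is_matcher s a b -> {subset avars a <= V} -> {subset avars b <= V} -> supported_on s V.
Proof.
move=> [sa out] aV bV; split=> x xV; first by apply: out; apply: contra xV; apply: aV.
case: (boolP (x \in avars a)) => [xa y ys|/out -> y /=]; last by rewrite inE => /eqP ->.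
by apply: bV; rewrite -sa; apply/avars_subst; exists x.
Qed.

Lemma body_sub cl : {subset gvars (body cl) <= cvars cl}.
Proof. by move=> x xb; rewrite mem_cat xb orbT. Qed.

Lemma head_sub cl : {subset avars (head cl) <= cvars cl}.
Proof. by move=> x xb; rewrite mem_cat xb. Qed.

Lemma gvars_mid G1 a G2 x :
  (x \in gvars (G1 ++ a :: G2)) = (x \in avars a) || (x \in gvars (G1 ++ G2)).
Proof. by rewrite !gvars_cat gvars_cons !mem_cat orbCA. Qed.

Lemma wf_unif c d : wf c -> unif_step Phi c d -> wf d.
Proof.
move=> wfc H; case: H wfc => k cl g G1 a G2 st V V' [_ [_ VV' clV']] mg sg [/= wG ws].
split=> [|x xX] /=.
  apply: gvars_supported => // x; rewrite !gvars_cat !mem_cat => /or3P [xG|xb|xG].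
  - by apply: VV'; apply: wG; rewrite gvars_mid gvars_cat mem_cat xG orbT.
  - by apply: clV'; apply: body_sub.
  - by apply: VV'; apply: wG; rewrite gvars_mid gvars_cat mem_cat xG !orbT.
by apply: tvars_supported => // y /(ws _ xX) /VV'.
Qed.

Lemma wf_sub c d : wf c -> sub_step Phi c d -> wf d.
Proof.
move=> wfc H; case: H wfc => k cl g G1 a G2 st V V' [_ [_ VV' clV']] mg sg [/= wG ws].
split=> [|x xX] /=; first by apply: gvars_supported => // x /wG /VV'.
by apply: tvars_supported => // y /(ws _ xX) /VV'.
Qed.

(** The same clause instance and the matcher itself give the LP-Unif step: clause variables are
    outside [used c], so the matcher changes neither the other atoms nor the state on [X]. *)
Lemma tm_unif c d :
  wf c -> tm_step Phi c d -> exists2 d', unif_step Phi c d' & variant d d'.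
Proof.
move=> wfc H; case: H wfc => k cl s G1 a G2 st V V' [inst [clV VV' clV']] ms [/= wG ws].
have aV : {subset avars a <= V} by move=> x xa; apply: wG; rewrite gvars_mid xa.
have sV : {in V, s =1 Var}.
  by move=> x xV; apply: ms.2; apply: contraL xV => /head_sub /clV.
have mg : is_mgu s (head cl) a.
  by apply: matcher_mgu => // x /aV; apply: contraL => /head_sub /clV.
have sg : supported_on s V'.
  by apply: matcher_supported ms _ _ => x; [move/head_sub/clV'|move/aV/VV'].
eexists; first exact: (UnifStep G1 G2 st (conj inst (And3 clV VV' clV')) mg sg).
apply: variant_id => /= [|x xX].
  have sG : {in gvars (G1 ++ G2), s =1 Var}.
    by move=> x xG; apply/sV/wG; rewrite gvars_mid xG orbT.
  rewrite !gsubst_cat (gsubst_id (G := G1)) ?(gsubst_id (G := G2)) // => x xG;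
    by apply: sG; rewrite gvars_cat mem_cat xG ?orbT.
by rewrite /subst_comp tsubst_id // => y /(ws _ xX) /sV.
Qed.

Lemma wf_tm c d : wf c -> tm_step Phi c d -> wf d.
Proof.
move=> wfc H; case: H wfc => k cl s G1 a G2 st V V' [inst [clV VV' clV']] ms [/= wG ws].
have aV : {subset avars a <= V} by move=> x xa; apply: wG; rewrite gvars_mid xa.
have sg : supported_on s V'.
  by apply: matcher_supported ms _ _ => x; [move/head_sub/clV'|move/aV/VV'].
split=> [x|x xX y] /=; last by move/(ws _ xX)/VV'.
rewrite !gvars_cat !mem_cat => /or3P [xG|xb|xG].
- by apply: VV'; apply: wG; rewrite gvars_mid gvars_cat mem_cat xG orbT.
- by apply: gvars_supported xb => // y /body_sub /clV'.
- by apply: VV'; apply: wG; rewrite gvars_mid gvars_cat mem_cat xG !orbT.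
Qed.

(** * Fresh instances and transport of steps along renamings *)

Lemma renamed_apart_intro k cl0 r V V' :
  (k, cl0) \in Phi -> injective r ->
  {in cvars (csubst (renaming F r) cl0), forall x, x \notin V} ->
  renamed_apart Phi k (csubst (renaming F r) cl0) V
    (V ++ cvars (csubst (renaming F r) cl0) ++ V').
Proof.
move=> kPhi inj disj; split; first by exists cl0, r.
by split=> // x; rewrite !mem_cat => ->; rewrite ?orbT.
Qed.

Lemma fresh_instance cl0 V :
  exists2 r, injective r & {in cvars (csubst (renaming F r) cl0), forall x, x \notin V}.
Proof.
have [r inj rV] := fresh_renaming V; exists r => // x.
by rewrite cvars_renaming => /mapP [y _ ->].
Qed.

(** One bijection [t] acts as [rho] on the variables of [c] and as the renaming between the two
    clause instances on those of [cl]; conjugating [g] by [t] gives [g']. Quantifying over [d] and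
    [d'] leaves the order of atoms and the bounds [used] free. *)
Lemma unif_transfer c c' rho a R cl0 r r' g V1 :
  wf c -> wf c' -> bijective rho -> perm_eq (cgoal c) (a :: R) ->
  perm_eq (cgoal c') (gsubst (renaming F rho) (cgoal c)) ->
  {in X, forall x, cstate c' x = tsubst (renaming F rho) (cstate c x)} ->
  injective r -> injective r' ->
  let cl := csubst (renaming F r) cl0 in
  let cl' := csubst (renaming F r') cl0 in
  {in cvars cl, forall x, x \notin used c} ->
  {in cvars cl', forall x, x \notin used c'} ->
  is_mgu g (head cl) a -> supported_on g V1 ->
  exists g' V1', [/\ is_mgu g' (head cl') (asubst (renaming F rho) a), supported_on g' V1' &
    forall d d', perm_eq (cgoal d) (gsubst g (body cl ++ R)) ->
      perm_eq (cgoal d') (gsubst g' (body cl' ++ gsubst (renaming F rho) R)) ->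
      cstate d = subst_comp g (cstate c) -> cstate d' = subst_comp g' (cstate c') ->
      variant d d'].
Proof.
move=> [wG ws] [wG' ws'] brho eG eG' est inj inj' cl cl' disj disj' mg sg.
have [p bp] := renaming_between cl0 inj inj'; rewrite -/cl -/cl' => clE.
pose W := gvars (a :: R) ++ flatten (map (fun x => tvars (cstate c x)) X).
have W_c x : x \in W -> x \in used c.
  rewrite mem_cat => /orP [|/flatten_mapP [y yX]]; last exact: ws.
  by rewrite -(perm_gvars eG); apply: wG.
have W_c' x : x \in W -> rho x \in used c'.
  rewrite mem_cat => /orP [xG|/flatten_mapP [y yX xy]].
    apply: wG'; rewrite (perm_gvars eG'); apply/gvars_subst; exists x; rewrite ?inE //.
    by rewrite (perm_gvars eG).
  by apply: (ws' y) => //; rewrite est //; apply/tvars_subst; exists x; rewrite ?inE.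
have p_c' x : x \in cvars cl -> p x \notin used c'.
  by move=> xc; apply: disj'; rewrite -clE cvars_renaming map_f.
(* The two pieces of [f] have disjoint images: [p] lands in the variables of [cl'], outside
   [used c'], and [rho] maps [W] into [used c']. *)
pose f x := if x \in cvars cl then p x else rho x.
have [|t bt tf] := @injective_in_extend (W ++ cvars cl) f.
  move=> x y; rewrite [x \in _]mem_cat [y \in _]mem_cat /f.
  case: (boolP (x \in cvars cl)) => xc; case: (boolP (y \in cvars cl)) => yc;
    rewrite ?orbT ?orbF => xW yW e.
  - exact: bij_inj bp _ _ e.
  - by case/negP: (p_c' _ xc); rewrite e W_c'.
  - by case/negP: (p_c' _ yc); rewrite -e W_c'.
  - exact: bij_inj brho _ _ e.
have memL x : (x \in W ++ cvars cl) = (x \in W) || (x \in cvars cl) by exact: mem_cat.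
have tW : {in W, renaming F t =1 renaming F rho}.
  move=> x xW; rewrite /renaming tf ?memL ?xW // /f ifN //.
  by apply: contraL (W_c _ xW); apply: disj.
have tcl : csubst (renaming F t) cl = cl'.
  by rewrite -clE; apply: csubst_renaming_ext => x xc; rewrite tf ?memL ?xc ?orbT // /f xc.
have ta : asubst (renaming F t) a = asubst (renaming F rho) a.
  by apply/eq_in_asubst => x xa; rewrite tW // !mem_cat xa.
have tR : gsubst (renaming F t) R = gsubst (renaming F rho) R.
  by apply/eq_in_gsubst => x xR; rewrite tW // !mem_cat xR orbT.
have [g' [V1' [mg' sg' g't]]] := mgu_conj mg sg bt.
exists g', V1'; split=> //; first by rewrite -ta -tcl.
move=> d d' ed ed' sd sd'; exists t; split=> //.
  rewrite (perm_trans ed') // perm_sym (perm_trans (perm_map _ ed)) // -/(gsubst _ _).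
  rewrite -tcl -tR -[body (csubst _ cl)]/(gsubst (renaming F t) (body cl)) -gsubst_cat !gsubst_comp.
  by rewrite (eq_in_gsubst (s' := subst_comp g' (renaming F t))) // => x _; rewrite /subst_comp /= g't.
move=> x xX; rewrite sd sd' /subst_comp est // !tsubst_comp; apply/eq_in_tsubst => y yx.
rewrite /subst_comp -g't /= tf /f.
  by rewrite ifN //; apply/(contraL _ (ws _ xX _ yx))/disj.
by rewrite !mem_cat orbC orbA; apply/orP; right; apply/flatten_mapP; exists x.
Qed.

Lemma unif_sim c c' d :
  wf c -> wf c' -> variant c c' -> unif_step Phi c d ->
  exists2 d', unif_step Phi c' d' & variant d d'.
Proof.
move=> wfc wfc' [rho [brho eG es]] H.
case: H wfc eG es => k cl g G1 a G2 st V V' [[cl0 [r [kPhi inj ->]]] [disj _ _]] mg sg.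
case: c' wfc' => G' st' V0 wfc' wfc eG es.
have [r' inj' disj'] := fresh_instance cl0 V0.
have eGa : perm_eq (G1 ++ a :: G2) (a :: (G1 ++ G2)) by rewrite (perm_catCA G1 [:: a] G2).
have [g' [V1' [mg' sg' var]]] :=
  unif_transfer wfc wfc' brho eGa eG es inj inj' disj disj' mg sg.
have eGa' : perm_eq G' (asubst (renaming F rho) a :: gsubst (renaming F rho) (G1 ++ G2)).
  by rewrite (perm_trans eG) // (perm_trans (perm_map _ eGa)).
have ra' := renamed_apart_intro V1' kPhi inj' disj'.
have sg'' : supported_on g' (V0 ++ cvars (csubst (renaming F r') cl0) ++ V1').
  by apply: supported_on_mono sg' _ => x xV; rewrite !mem_cat xV !orbT.
have [G'' step eG''] := unif_step_at st' eGa' ra' mg' sg''.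
exists (Config G'' (subst_comp g' st') (V0 ++ cvars (csubst (renaming F r') cl0) ++ V1')) => //.
by apply: var => //=; apply: perm_map; rewrite perm_catCA perm_cat2l.
Qed.

(** A substitution matching the head, such as an mgu, may also instantiate variables occurring only
    in the body, which [is_matcher] forbids. The new matcher leaves them as the variables [p x] of
    the second instance. *)
Lemma rename_matcher cl0 r r' s a :
  injective r -> injective r' ->
  let cl := csubst (renaming F r) cl0 in
  let cl' := csubst (renaming F r') cl0 in
  asubst s (head cl) = a ->
  exists s' p, [/\ bijective p, is_matcher s' (head cl') a,
    {in cvars cl, forall x, p x \in cvars cl'} &
    gsubst s' (body cl') =
      gsubst (fun x => if x \in avars (head cl) then s x else Var (p x)) (body cl)].
Proof.
move=> inj inj' cl cl' sC; have [p bp] := renaming_between cl0 inj inj'.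
rewrite -/cl -/cl' => clE; have [q pK qK] := bp.
pose s' x := if x \in avars (head cl') then s (q x) else Var x.
have s'p x : s' (p x) = if x \in avars (head cl) then s x else Var (p x).
  rewrite /s' pK; congr (if _ then _ else _); rewrite -clE.
  apply/avars_subst/idP => [[y yC]|xC]; last by exists x; rewrite ?inE.
  by rewrite inE => /eqP /(bij_inj bp) ->.
exists s', p; split=> //.
- split=> [|x xC]; last by rewrite /s' ifN.
  rewrite -clE -sC asubst_comp; apply/eq_in_asubst => x xC.
  by rewrite /subst_comp /= s'p xC.
- by move=> x xc; rewrite -clE cvars_renaming map_f.
- by rewrite -clE gsubst_comp; apply/eq_in_gsubst => x xB; rewrite /subst_comp /= s'p.
Qed.

(** After [g], the atom [asubst g a] is matched by a fresh instance of the same clause. The two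
    results differ only at variables occurring in the body but not in the head: [g x] on one side,
    [p x] on the other. By [mgu_fresh] this is a mere renaming. *)
Lemma unif_as_sub_tm G1 a G2 st V k cl g V' :
  wf (Config (G1 ++ a :: G2) st V) -> renamed_apart Phi k cl V V' ->
  is_mgu g (head cl) a -> supported_on g V' ->
  exists2 u, tm_step Phi (Config (gsubst g (G1 ++ a :: G2)) (subst_comp g st) V') u &
    variant (Config (gsubst g (G1 ++ body cl ++ G2)) (subst_comp g st) V') u.
Proof.
move=> [/= wG ws] [[cl0 [r [kPhi inj clE]]] [disj VV' clV']] mg sg.
have [r' inj' disj'] := fresh_instance cl0 V'.
have gC := mg.1; rewrite clE in gC.
have [s' [p [bp ms' pcl sB]]] := rename_matcher inj inj' gC; rewrite -clE in pcl sB.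
have eGa : perm_eq (gsubst g (G1 ++ a :: G2)) (asubst g a :: gsubst g (G1 ++ G2)).
  by rewrite !gsubst_cat (perm_catCA _ [:: _]).
have [G' step eG'] :=
  tm_step_at (subst_comp g st) eGa (renamed_apart_intro [::] kPhi inj' disj') ms'.
eexists; first exact: step.
pose Y := [seq x <- cvars cl | x \notin avars (head cl)].
have [|||t bt tg] := @mgu_fresh F P g (head cl) a V' Y p mg sg.
- move=> x; rewrite mem_filter => /andP [-> /disj xV] /=.
  by apply: contra xV => xa; apply: wG; rewrite gvars_mid xa.
- by move=> x; rewrite mem_filter => /andP [_ /pcl /disj'].
- by move=> x y _ _; apply: bij_inj.
(* Thus [t] disturbs neither the remaining atoms nor the state. *)
have tV x : x \in V -> tsubst (renaming F t) (g x) = g x.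
  move=> xV; rewrite tg ?VV' // ifN // mem_filter negb_and; apply/orP; right.
  by apply: contraL xV; apply: disj.
exists t; split=> //=.
  rewrite (perm_trans eG') // perm_sym.
  rewrite (perm_trans (y := gsubst (renaming F t) (gsubst g (body cl ++ G1 ++ G2)))) //.
    by do 2!apply: perm_map; rewrite (perm_catCA G1).
  rewrite sB gsubst_comp gsubst_cat.
  suff [-> ->] : gsubst (subst_comp (renaming F t) g) (body cl) =
      gsubst (fun x => if x \in avars (head cl) then g x else Var (p x)) (body cl) /\
    gsubst (subst_comp (renaming F t) g) (G1 ++ G2) = gsubst g (G1 ++ G2) by [].
  split.
    apply: eq_in_gsubst => x xB; have xc := body_sub xB.
    by rewrite /subst_comp tg ?clV' // mem_filter xc andbT; case: (x \in _).
  by apply: eq_in_gsubst => x xG; apply: tV; apply: wG; rewrite gvars_mid xG orbT.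
move=> x xX; rewrite /subst_comp tsubst_comp; apply/eq_in_tsubst => y yx.
by rewrite /subst_comp tV //; apply: ws yx.
Qed.

(** * Commutation of term-matching with LP-Unif *)

Hypothesis labels : distinct_labels Phi.
Hypothesis nonoverlap : non_overlapping Phi.

(** Non-overlap rules out different labels, and distinctness of labels makes a label determine its
    clause. *)
Lemma clause_unique k1 k2 cl1 cl2 s1 s2 :
  (k1, cl1) \in Phi -> (k2, cl2) \in Phi ->
  asubst s1 (head cl1) = asubst s2 (head cl2) -> k1 = k2 /\ cl1 = cl2.
Proof.
move=> Phi1 Phi2 e; case: (eqVneq k1 k2) => [ek|nk]; last first.
  by case: (nonoverlap Phi1 Phi2 nk); exists s1, s2.
split=> //; rewrite ek in Phi1.
move: labels Phi1 Phi2; rewrite /distinct_labels.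
elim: (Phi : seq _) => [|[k cl] L IH] //= /andP [kL uL]; rewrite !inE.
case/orP=> [/eqP [ek1 ->]|in1]; case/orP=> [/eqP [ek2 ->]|in2] //.
- by case/negP: kL; rewrite -ek1; apply/mapP; exists (k2, cl2).
- by case/negP: kL; rewrite -ek2; apply/mapP; exists (k2, cl1).
exact: IH.
Qed.

(** The split is on equality of the atoms, not of their positions: removing either of two equal
    atoms leaves the same multiset. *)
Lemma perm_two_atoms G1 a G2 H1 b H2 :
  G1 ++ a :: G2 = H1 ++ b :: H2 ->
  a = b /\ perm_eq (G1 ++ G2) (H1 ++ H2) \/
  exists R, perm_eq (G1 ++ G2) (b :: R) /\ perm_eq (H1 ++ H2) (a :: R).
Proof.
move=> e; have: perm_eq (a :: G1 ++ G2) (b :: H1 ++ H2).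
  by rewrite -(perm_catCA G1 [:: a]) perm_sym -(perm_catCA H1 [:: b]) perm_sym /= e.
case: (eqVneq a b) => [->|nab ep]; first by rewrite perm_cons; left.
right; have bG : b \in G1 ++ G2.
  by move: (perm_mem ep b); rewrite mem_head inE eq_sym (negPf nab).
exists (rem b (G1 ++ G2)); have eR := perm_to_rem bG; split=> //.
rewrite -(perm_cons b) perm_sym -(perm_catCA [:: a] [:: b]) /=.
by rewrite perm_sym -(permPl ep) perm_cons.
Qed.

(** The clause instance behind [d2] may clash with variables introduced in [d1]. The diamond
    therefore starts from a variant [d2'], whose instance is fresh for both [c] and [d1], so that
    the same mgu acts at both. *)
Lemma tm_unif_commute c d1 d2 :
  wf c -> tm_step Phi c d1 -> unif_step Phi c d2 ->
  variant d1 d2 \/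
  exists d2' e1 e2, [/\ unif_step Phi c d2', variant d2 d2', unif_step Phi d1 e1,
    tm_step Phi d2' e2 & variant e1 e2].
Proof.
move=> wfc T1 T2; have wfd1 := wf_tm wfc T1.
have bid : bijective (@id nat) by exists id.
case: T1 wfc T2 wfd1 => k1 cl1 s1 G1 a G2 st V V1 ra1 ms wfc T2 wfd1.
case eqc: _ _ / T2 => [k2 cl2 g H1 b H2 st2 VV V2 ra2 mg sg].
case: eqc ra2 => eG <- <- {st2 VV} ra2.
case: (wfc) => /= wG ws.
have [[cl01 [r1 [Phi1 inj1 cl1E]]] [disj1 VV1 cl1V1]] := ra1.
have [[cl02 [r2 [Phi2 inj2 cl2E]]] [disj2 VV2 cl2V2]] := ra2.
have aV : {subset avars a <= V} by move=> x xa; apply: wG; rewrite gvars_mid xa.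
have s1V : {in V, s1 =1 Var}.
  by move=> x xV; apply: ms.2; apply: contraL xV => /head_sub /disj1.
have s1G : gsubst s1 (G1 ++ G2) = G1 ++ G2.
  by apply: gsubst_id => x xG; apply: s1V; apply: wG; rewrite gvars_mid xG orbT.
have mg1 : is_mgu s1 (head cl1) a.
  by apply: matcher_mgu => // x /aV; apply: contraL => /head_sub /disj1.
have eGb : perm_eq (G1 ++ a :: G2) (b :: H1 ++ H2).
  by rewrite eG (perm_catCA H1 [:: b]).
have eGid : perm_eq (G1 ++ a :: G2) (gsubst (renaming F id) (G1 ++ a :: G2)).
  by rewrite gsubst_id.
have esid : {in X, forall x, st x = tsubst (renaming F id) (st x)}.
  by move=> x _; rewrite tsubst_id.
case: (perm_two_atoms eG) => [[eab eR]|[R [eR1 eR2]]]; [left|right].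
  (* Both heads have a common instance with the selected atom, so the two steps use the same program
     clause. *)
  have [ek ecl] : k1 = k2 /\ cl01 = cl02.
    apply: (clause_unique Phi1 Phi2 (s1 := subst_comp (subst_comp g s1) (renaming F r1))
      (s2 := subst_comp g (renaming F r2))).
    rewrite -!asubst_comp -[asubst (renaming F r1) _]/(head (csubst _ cl01)).
    rewrite -[asubst (renaming F r2) _]/(head (csubst _ cl02)) -cl1E -cl2E.
    by rewrite ms.1 mg.1 eab.
  subst k2 cl02 b cl2.
  rewrite cl1E in disj1.
  (* Once [g] is transferred to the instance [cl1], both [s1] and [g'] are mgus of the same pair,
     and [mgu_unique] applies. *)
  have [g' [V2' [mg' sg' var]]] :=
    unif_transfer wfc wfc bid eGb eGid esid inj2 inj1 disj2 disj1 mg sg.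
  rewrite -cl1E asubst_id // in mg'.
  have [t bt tE] := mgu_unique (V ++ cvars cl1) mg1 mg'.
  pose m := Config (gsubst g' (body cl1 ++ H1 ++ H2)) (subst_comp g' st) V.
  apply: (@variant_trans _ m); last first.
    apply/variant_sym/var => //; last by rewrite -cl1E (gsubst_id (s := renaming F id)).
    by apply: perm_map; rewrite (perm_catCA H1).
  exists t; split=> //=.
    rewrite perm_sym (perm_trans (y := gsubst (renaming F t) (gsubst s1 (body cl1 ++ G1 ++ G2)))) //.
      by apply: perm_map; rewrite gsubst_cat s1G (perm_catCA G1).
    rewrite gsubst_comp -(eq_in_gsubst (s := g')) => [|x].
      by apply: perm_map; rewrite perm_cat2l.
    rewrite gvars_cat mem_cat => xBG; apply: tE; rewrite [_ \in _]mem_cat.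
    by case/orP: xBG => [/body_sub -> | xG]; rewrite ?orbT // wG // gvars_mid xG orbT.
  move=> x xX; rewrite /subst_comp; apply/eq_in_tsubst => y yx.
  by have yV := ws _ xX _ yx; rewrite tE ?mem_cat ?yV // s1V.
have [r2' inj2' disj2'] := fresh_instance cl02 (V ++ V1).
rewrite cl2E in mg disj2.
have disj2V : {in cvars (csubst (renaming F r2') cl02), forall x, x \notin V}.
  by move=> x /disj2'; rewrite mem_cat => /norP [].
have disj2V1 : {in cvars (csubst (renaming F r2') cl02), forall x, x \notin V1}.
  by move=> x /disj2'; rewrite mem_cat => /norP [].
have [g' [V2' [mg' sg' var]]] :=
  unif_transfer wfc wfc bid eGb eGid esid inj2 inj2' disj2 disj2V mg sg.
rewrite asubst_id // in mg'.
(* Adding [V1] to the bound [Vc] makes it contain the variables of [cl1], on which [mgu_fresh] is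
   used below. *)
have rac := renamed_apart_intro (V1 ++ V2') Phi2 inj2' disj2V.
have rad := renamed_apart_intro V2' Phi2 inj2' disj2V1.
set cl2' := csubst (renaming F r2') cl02 in rac rad var mg' disj2V disj2V1.
set Vc := V ++ _ in rac; set Vd := V1 ++ _ in rad.
have sgc : supported_on g' Vc.
  by apply: supported_on_mono sg' _ => x; rewrite !mem_cat => ->; rewrite !orbT.
have sgd : supported_on g' Vd.
  by apply: supported_on_mono sg' _ => x; rewrite !mem_cat => ->; rewrite !orbT.
have eGd : perm_eq (G1 ++ gsubst s1 (body cl1) ++ G2) (b :: gsubst s1 (body cl1) ++ R).
  by rewrite (perm_catCA G1) perm_sym (perm_catCA [:: b]) perm_cat2l perm_sym.
have [Gm stepm eGm] := unif_step_at st eGb rac mg' sgc.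
have [Ge stepe eGe] := unif_step_at st eGd rad mg' sgd.
have [r1' inj1' disj1'] := fresh_instance cl01 Vc.
(* The atom [a] survives the LP-Unif step as [asubst g' a], still an instance of the head of [cl1];
   this gives the closing term-matching step. *)
have sC : asubst (subst_comp g' s1) (head cl1) = asubst g' a by rewrite -asubst_comp ms.1.
rewrite cl1E in sC.
have [s3 [p [bp ms3 pcl sB]]] := rename_matcher inj1 inj1' sC.
rewrite -cl1E in pcl sB.
have eGma : perm_eq Gm (asubst g' a :: gsubst g' (body cl2' ++ R)).
  rewrite (perm_trans eGm) // -[_ :: _]/(gsubst g' (a :: body cl2' ++ R)); apply: perm_map.
  by rewrite perm_sym (perm_catCA [:: a]) perm_cat2l perm_sym.
have [Ge' stepe' eGe'] := tm_step_at (subst_comp g' st) eGma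
  (renamed_apart_intro [::] Phi1 inj1' disj1') ms3.
pose d2' := Config Gm (subst_comp g' st) Vc.
pose e1 := Config Ge (subst_comp g' st) Vd.
exists d2', e1; eexists; split; [by rewrite -eG | | exact: stepe | exact: stepe' |].
  rewrite cl2E; apply: var => //; first by apply: perm_map; rewrite (perm_catCA H1).
  by rewrite (gsubst_id (s := renaming F id)).
(* Body variables of [cl1] outside its head become [g' x] in [e1] and [p x] in [e2]; [t] reconciles
   them. *)
pose Y := [seq x <- cvars cl1 | x \notin avars (head cl1)].
have [|||t bt tg] := @mgu_fresh F P g' (head cl2') b Vc Y p mg' sgc.
- move=> x; rewrite mem_filter => /andP [_ xc]; apply/andP; split.
    by apply: contraL (cl1V1 _ xc) => /head_sub /disj2V1.
  by apply: contra (disj1 _ xc) => xb; apply: wG; rewrite /= eG gvars_mid xb.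
- by move=> x; rewrite mem_filter => /andP [_ /pcl /disj1'].
- by move=> x y _ _; apply: bij_inj.
have tN x : x \in Vc -> x \notin cvars cl1 -> tsubst (renaming F t) (g' x) = g' x.
  by move=> xV xc; rewrite tg // ifN // mem_filter negb_and xc orbT.
have tV x : x \in V -> tsubst (renaming F t) (g' x) = g' x.
  move=> xV; apply: tN; first by rewrite mem_cat xV.
  by apply: contraL xV; apply: disj1.
exists t; split=> //=.
  rewrite (perm_trans eGe') // perm_sym.
  rewrite (perm_trans (perm_map _ eGe)) // -/(gsubst _ _).
  rewrite (perm_trans (y := gsubst (renaming F t) (gsubst g' (gsubst s1 (body cl1) ++ body cl2' ++ R)))) //.
    by do 2!apply: perm_map; rewrite perm_catCA.
  rewrite sB 2!gsubst_cat !(gsubst_comp (renaming F t) g') gsubst_comp.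
  suff [-> ->] : gsubst (subst_comp (subst_comp (renaming F t) g') s1) (body cl1) =
      gsubst (fun x => if x \in avars (head cl1) then subst_comp g' s1 x else Var (p x)) (body cl1) /\
    gsubst (subst_comp (renaming F t) g') (body cl2' ++ R) = gsubst g' (body cl2' ++ R) by [].
  split; apply: eq_in_gsubst => x.
    move=> /body_sub xc; rewrite /subst_comp; case: ifP => xC.
      apply/eq_in_tsubst => y yx; apply: tV; apply: aV; rewrite -ms.1.
      by apply/avars_subst; exists x.
    rewrite ms.2 ?xC //= tg ?mem_filter ?xC ?xc //.
    by rewrite !mem_cat cl1V1 ?orbT.
  rewrite gvars_cat mem_cat => /orP [/body_sub xc|xR].
    apply: tN; first by rewrite mem_cat [X in _ || X]mem_cat xc orbT.
    by apply: contra (disj2V1 _ xc); apply: cl1V1.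
  apply: tV; apply: wG; rewrite /= gvars_mid (perm_gvars eR1) gvars_cons mem_cat xR.
  by rewrite !orbT.
move=> x xX; rewrite /subst_comp tsubst_comp; apply/eq_in_tsubst => y yx.
by rewrite /subst_comp tV //; apply: ws yx.
Qed.

(** * LP-Unif and LP-Struct reductions *)

Local Notation ustep := (unif_step Phi).
Local Notation upath := (path_of_length (unif_step Phi)).
Local Notation tpath := (path_of_length (tm_step Phi)).

Lemma wf_upath n c d : upath n c d -> wf c -> wf d.
Proof. by elim=> // {}n x y z xy _ IH /wf_unif /(_ xy). Qed.

Lemma wf_tpath n c d : tpath n c d -> wf c -> wf d.
Proof. by elim=> // {}n x y z xy _ IH /wf_tm /(_ xy). Qed.

Lemma sub_path1_cases n w e : sub_path1 Phi n w e -> w = e \/ sub_step Phi w e.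
Proof.
case; case: n => [|[|//]] _ p; first by left; apply: path0_eq p.
by have [x wx xe] := pathS_inv p; right; rewrite -(path0_eq xe).
Qed.

Lemma wf_struct_step c e : struct_step Phi c e -> wf c -> wf e.
Proof.
move=> [_ [l [n [w [[cw _] /sub_path1_cases we _]]]]] wfc.
have wfw := wf_tpath cw wfc; case: we => [<- //|]; exact: wf_sub.
Qed.

Lemma wf_struct_path n c d : path_of_length (struct_step Phi) n c d -> wf c -> wf d.
Proof. by elim=> // {}n x y z xy _ IH /(wf_struct_step xy). Qed.

Lemma upath_sim n c c' d :
  upath n c d -> wf c -> wf c' -> variant c c' -> exists2 d', upath n c' d' & variant d d'.
Proof.
move=> p; elim: p c' => {n c d} [c|n c u d cu _ IH] c' wfc wfc' cc'.
  by exists c' => //; apply: path_nil.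
have [u' cu' uu'] := unif_sim wfc wfc' cc' cu.
have [d' ud' dd'] := IH _ (wf_unif wfc cu) (wf_unif wfc' cu') uu'.
by exists d' => //; apply: path_cons ud'.
Qed.

Lemma irreducible_variant d d' :
  wf d -> wf d' -> variant d d' -> irreducible ustep d -> irreducible ustep d'.
Proof.
move=> wfd wfd' /variant_sym dd' irr [e /(unif_sim wfd' wfd dd') [e' de' _]].
by apply: irr; exists e'.
Qed.

(** Induction on [n], comparing the term-matching step with the first step of the path. Either they
    agree and the tail is transported, or the diamond carries the term-matching step past it to a
    shorter path. *)
Lemma upath_tm n c d c1 :
  upath n c d -> wf c -> irreducible ustep d -> tm_step Phi c c1 ->
  exists m d1, [/\ n = m.+1, upath m c1 d1 & variant d d1].
Proof.
elim: n c d c1 => [|n IH] c d c1 p wfc irr cc1.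
  (* An empty path would make [c] normal, yet a term-matching step yields an LP-Unif step. *)
  by have [d' cd' _] := tm_unif wfc cc1; case: irr; exists d'; rewrite -(path0_eq p).
have [u cu ud] := pathS_inv p.
have wfu := wf_unif wfc cu; have wfc1 := wf_tm wfc cc1.
case: (tm_unif_commute wfc cc1 cu) => [c1u|[u' [e1 [e2 [cu' uu' c1e1 u'e2 e12]]]]].
  by have [d1] := upath_sim ud wfu wfc1 (variant_sym c1u); exists n, d1.
have wfu' := wf_unif wfc cu'.
have [d' u'd' dd'] := upath_sim ud wfu wfu' uu'.
have wfd := wf_upath ud wfu; have wfd' := wf_upath u'd' wfu'.
have [m [d2 [-> e2d2 d'd2]]] :=
  IH _ _ _ u'd' wfu' (irreducible_variant wfd wfd' dd' irr) u'e2.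
have [d3 e1d3 d2d3] :=
  upath_sim e2d2 (wf_tm wfu' u'e2) (wf_unif wfc1 c1e1) (variant_sym e12).
exists m.+1, d3; split=> //; first exact: path_cons c1e1 e1d3.
exact: variant_trans (variant_trans dd' d'd2) d2d3.
Qed.

(** Each term-matching step shortens the remaining LP-Unif path by one, so matching stops within [n]
    steps. The bound [m <= n] serves the strong induction of [unif_struct]. *)
Lemma upath_mu n c d :
  upath n c d -> wf c -> irreducible ustep d ->
  exists l m c' d', [/\ mu_path Phi l c c', upath m c' d', variant d d' & m <= n].
Proof.
elim: n c d => [|n IH] c d p wfc irr; case: (classic (irreducible (tm_step Phi) c)) => irrt.
- by exists 0, 0, c, d; split=> //; [split=> //; apply: path_nil | apply: variant_refl].
- by case: irrt => -[c1 /(upath_tm p wfc irr) [m [d1 []]]].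
- by exists 0, n.+1, c, d; split=> //; [split=> //; apply: path_nil | apply: variant_refl].
have [c1 cc1] := NNPP _ irrt.
have [m [d1 [[<-] c1d1 dd1]]] := upath_tm p wfc irr cc1.
have wfc1 := wf_tm wfc cc1.
have wfd1 := wf_upath c1d1 wfc1.
have irr1 := irreducible_variant (wf_upath p wfc) wfd1 dd1 irr.
have [l [m' [c' [d' [[c1c' irrc'] c'd' d1d' le]]]]] := IH _ _ c1d1 wfc1 irr1.
exists l.+1, m', c', d'; split=> //; last exact: leqW.
  by split=> //; apply: path_cons cc1 c1c'.
exact: variant_trans d1d'.
Qed.

Lemma sub_step_split c e :
  wf c -> sub_step Phi c e ->
  exists u u', [/\ ustep c u, tm_step Phi e u' & variant u u'].
Proof.
move=> wfc ce; case: ce wfc => k cl g G1 a G2 st V V' ra mg sg wfc.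
have [u' eu' uu'] := unif_as_sub_tm wfc ra mg sg.
by eexists; exists u'; split; [exact: UnifStep ra mg sg | exact: eu' | exact: uu'].
Qed.

Lemma unif_step_split c u :
  wf c -> ustep c u ->
  exists e u', [/\ sub_step Phi c e, tm_step Phi e u' & variant u u'].
Proof.
move=> wfc cu; case: cu wfc => k cl g G1 a G2 st V V' ra mg sg wfc.
have [u' eu' uu'] := unif_as_sub_tm wfc ra mg sg.
by eexists; exists u'; split; [exact: SubStep ra mg sg | exact: eu' | exact: uu'].
Qed.

Lemma struct_step_intro l n c w e :
  mu_path Phi l c w -> sub_path1 Phi n w e -> struct_step Phi c e.
Proof. by move=> cw we; exists (l + n), l, n, w. Qed.

(** The first matching phase is kept apart from the LP-Struct path, so that the term-matching step
    completing a unification can be prepended to the phase that follows. *)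
Lemma unif_struct n c d :
  upath n c d -> wf c -> irreducible ustep d ->
  exists l w d', [/\ mu_path Phi l c w, star (struct_step Phi) w d' & variant d d'].
Proof.
elim/ltn_ind: n c d => n IH c d p wfc irr.
have [l [m [w [d' [cw wd' dd' le_mn]]]]] := upath_mu p wfc irr.
have wfw := wf_tpath cw.1 wfc; have wfd' := wf_upath wd' wfw.
have irr' := irreducible_variant (wf_upath p wfc) wfd' dd' irr.
exists l, w; case: m wd' le_mn => [|m] wd' le_mn.
  by exists w; split=> //; [exists 0; apply: path_nil | rewrite (path0_eq wd')].
have [u wu ud'] := pathS_inv wd'.
have [e [u' [we eu' uu']]] := unif_step_split wfw wu.
have wfe := wf_sub wfw we; have wfu' := wf_tm wfe eu'; have wfu := wf_unif wfw wu.
have [d2 u'd2 d'd2] := upath_sim ud' wfu wfu' uu'.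
have irrd' := irreducible_variant wfd' (wf_upath u'd2 wfu') d'd2 irr'.
have [l' [v [z [[u'v irrv] [q vz] d2z]]]] := IH _ le_mn _ _ u'd2 wfu' irrd'.
exists z; split=> //; last exact: variant_trans (variant_trans dd' d'd2) d2z.
(* One unification costs two LP-Struct steps: an empty matching phase with a substitutional step to
   [e], then matching from [e] to [v] with no substitutional step. *)
exists q.+2; apply: (path_cons (y := e)); last apply: (path_cons (y := v)) => //.
  apply: (struct_step_intro (l := 0) (w := w) (n := 1)).
    by split; [apply: path_nil | apply: cw.2].
  by split=> //; apply: path_cons we _; apply: path_nil.
apply: (struct_step_intro (l := l'.+1) (w := v) (n := 0)).
  by split=> //; apply: path_cons eu' u'v.
by split=> //; apply: path_nil.
Qed.

Lemma tpath_upath l c w m d :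
  tpath l c w -> wf c -> upath m w d -> exists n d', upath n c d' /\ variant d d'.
Proof.
elim=> {l c w} [c|l c u w cu uw IH] wfc wd.
  by exists m, d; split=> //; apply: variant_refl.
have wfu := wf_tm wfc cu; have [n [d' [ud' dd']]] := IH wfu wd.
have [u' cu' uu'] := tm_unif wfc cu.
have [d2 u'd2 d'd2] := upath_sim ud' wfu (wf_unif wfc cu') uu'.
exists n.+1, d2; split; first exact: path_cons cu' u'd2.
exact: variant_trans d'd2.
Qed.

Lemma struct_unif n c d :
  path_of_length (struct_step Phi) n c d -> wf c -> irreducible ustep d ->
  exists m d', upath m c d' /\ variant d d'.
Proof.
move=> p; elim: p => {n c d} [c|n c e d ce ed IH] wfc irr.
  by exists 0, c; split; [apply: path_nil | apply: variant_refl].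
have wfe := wf_struct_step ce wfc; have wfd := wf_struct_path ed wfe.
have [m [d' [ed' dd']]] := IH wfe irr.
case: ce => _ [l [n2 [w [[cw irrw] /sub_path1_cases we _]]]]; have wfw := wf_tpath cw wfc.
suff [m2 [d2 [wd2 dd2]]] : exists m d', upath m w d' /\ variant d d'.
  have [n' [d3 [cd3 d2d3]]] := tpath_upath cw wfc wd2.
  by exists n', d3; split=> //; apply: variant_trans d2d3.
case: we => [->|we]; first by exists m, d'.
(* The LP-Unif step from [w] to [u] replaces the substitutional step together with the matching from
   [e] to [u']; [upath_tm] removes that matching from the path starting at [e]. *)
have [u [u' [wu eu' uu']]] := sub_step_split wfw we.
have wfu := wf_unif wfw wu; have wfu' := wf_tm wfe eu'.
have irr' := irreducible_variant wfd (wf_upath ed' wfe) dd' irr.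
have [m' [d2 [_ u'd2 d'd2]]] := upath_tm ed' wfe irr' eu'.
have [d3 ud3 d2d3] := upath_sim u'd2 wfu' wfu (variant_sym uu').
exists m'.+1, d3; split; first exact: path_cons wu ud3.
exact: variant_trans (variant_trans dd' d'd2) d2d3.
Qed.

End Configurations.

(** * Normal forms of the two relations *)

Section Normality.

Variables (F P K : eqType) (Phi : program F P K).

Lemma wf_init (A : goal F P) : wf (gvars A) (init A).
Proof. by split=> [//|x xA y] /=; rewrite inE => /eqP ->. Qed.

Lemma wf_nil (X : seq nat) (c : config F P) : wf X c -> wf [::] c.
Proof. by case. Qed.

(** Term-matching and substitutional steps each give an LP-Unif step from the same goal, and an
    LP-Unif step gives a substitutional one. *)
Lemma unif_normal_struct (C : goal F P) : unif_normal Phi C <-> struct_normal Phi C.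
Proof.
have wfC := wf_init C; split=> [irr|[no_inf only0] [d Cd]].
  have irrt : irreducible (tm_step Phi) (init C).
    by move=> [d /(tm_unif wfC) [d' Cd' _]]; apply: irr; exists d'.
  split=> [[f [f0 fS]]|n c' [n1 [n2 [w [[Cw _] [le_n2 wc'] ->]]]]].
    by apply: irrt; exists (f 1); rewrite -f0.
  case: n1 Cw => [|n1] Cw; last by have [d Cd _] := pathS_inv Cw; case: irrt; exists d.
  rewrite -(path0_eq Cw) in wc'; case: n2 {le_n2} wc' => // n2 wc'.
  have [d Cd _] := pathS_inv wc'; exfalso.
  by case: (sub_step_split wfC Cd) => u [_ [Cu _ _]]; case: irr; exists u.
(* Without infinite matching there is some [mu_path]; being an LP-Struct path it has length 0, so
   [C] is already matching-normal and a substitutional step would be a path of length 1. *)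
have [n [w mu]] := terminating_normal no_inf.
have n0 : n = 0.
  apply: (only0 _ w); exists n, 0, w; rewrite addn0.
  by split=> //; split=> //; apply: path_nil.
move: mu; rewrite {}n0 => -[Cw irrt]; rewrite -(path0_eq Cw) in irrt.
have [e [_ [Ce _ _]]] := unif_step_split wfC Cd.
suff: 1 = 0 by []; apply: (only0 _ e); exists 0, 1, (init C); split=> //.
  by split=> //; apply: path_nil.
by split=> //; apply: path_cons Ce _; apply: path_nil.
Qed.

(** Normality depends only on the goal up to renaming, so [X] is shrunk to [[::]] to forget both
    states. *)
Lemma answer_normal (X : seq nat) c (C : goal F P) g V :
  wf X c -> variant X c (Config C g V) -> unif_normal Phi C -> irreducible (unif_step Phi) c.
Proof.
move=> /wf_nil wfc [r [br pr _]]; apply: irreducible_variant (wf_nil (wf_init C)) wfc _.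
by apply: variant_sym; exists r; split.
Qed.

End Normality.

Theorem theorem9 (F P K : eqType) (Phi : program F P K)
    (labels : distinct_labels Phi) (nonoverlap : non_overlapping Phi)
    (A C : goal F P) (g : subst F) :
  (unif_reduces Phi A g C /\ unif_normal Phi C) <->
  (struct_reduces Phi A g C /\ struct_normal Phi C).
Proof.
have wfA := wf_init A; rewrite -unif_normal_struct.
split=> -[[c [[n Ac] ans]] normC]; split=> //.
  have irrc : irreducible (unif_step Phi) c.
    exact: (answer_normal (V := [::]) (wf_upath Ac wfA) ans normC).
  have [l [w [d [Aw [m wd] cd]]]] := unif_struct labels nonoverlap Ac wfA irrc.
  exists d; split; last first.
    (* By conversion, an [answer_variant] is a [variant] on [gvars A] towards [Config C g [::]]. *)
    exact: (variant_trans (e := Config C g [::]) (variant_sym cd) ans).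
  (* The leading matching phase becomes an LP-Struct step with an empty substitutional part. *)
  exists m.+1; apply: path_cons wd; apply: (struct_step_intro Aw (n := 0)).
  by split=> //; apply: path_nil.
have irrc : irreducible (unif_step Phi) c.
  exact: (answer_normal (V := [::]) (wf_struct_path Ac wfA) ans normC).
have [m [d [Ad cd]]] := struct_unif labels nonoverlap Ac wfA irrc.
exists d; split; first by exists m.
exact: (variant_trans (e := Config C g [::]) (variant_sym cd) ans).
Qed.
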